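(* For each $\varepsilon>0$ there is a constant $c_\varepsilon\in(0,\infty)$ such that for any integer $N\ge 2$ and any nearest neighbor path $\mathcal{P}=(P_0,P_1,\dots,P_K)\subset\mathbb{Z}^3$ connecting $0$ and $\partial B_1(0,N)$, we have $$P\left(\mathrm{Trace}(\mathcal{P})\subseteq \mathrm{Trace}\big(\{X_{3,n}\}_{n=0}^\infty\big)\right)\le \exp\left(-c_\varepsilon N\log^{-(1+\varepsilon)}(N)\right),$$ where $\{X_{3,n}\}_{n=0}^\infty$ is a simple random walk on $\mathbb{Z}^3$ starting at $0$.
   Context: $\{X_{3,n}\}_{n=0}^\infty$ is the $3$-dimensional simple random walk, i.e. the nearest neighbor walk on $\mathbb{Z}^3$ that at each step jumps to one of the $6$ neighbors $\pm e_i$ ($i=1,2,3$) with probability $1/6$ each, independently. $\partial B_1(0,N)=\{x\in\mathbb{Z}^3:\|x\|_1=N\}$ is the boundary of the $L_1$ ball of radius $N$. A nearest neighbor path $\mathcal{P}=(P_0,\dots,P_K)$ is a finite sequence of points of $\mathbb{Z}^3$ with consecutive points at $L_1$ distance $1$; it is said to connect $0$ and $\partial B_1(0,N)$ if $P_0=0$ and $\inf\{n:\|P_n\|_1=N\}=K$ (that is, the path first reaches $L_1$ norm $N$ at its last point). The trace of a finite or infinite sequence of points is the set of points it visits: $\mathrm{Trace}(\mathcal{P})=\{P_0,\dots,P_K\}$ and $\mathrm{Trace}(\{X_{3,n}\}_{n=0}^\infty)=\{x\in\mathbb{Z}^3:\exists n\ge 0,\ X_{3,n}=x\}$. Here $\log$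 is the natural logarithm and $\log^{a}(N)$ means $(\log N)^{a}$. *)

(* Defs.v *)
From mathcomp Require Import all_boot all_order all_algebra.
From mathcomp Require Import all_classical all_reals all_analysis.

Set Implicit Arguments.
Unset Strict Implicit.
Unset Printing Implicit Defensive.
Import Order.TTheory GRing.Theory Num.Theory.
Local Open Scope classical_set_scope.
Local Open Scope ring_scope.

Notation Z3 := 'rV[int]_3.

Definition l1norm (x : Z3) : nat := (\sum_(i < 3) `|x 0%R i|)%N.

Definition nearest_neighbor (K : nat) (p : K.+1.-tuple Z3) : Prop :=
  sorted (fun x y : Z3 => l1norm (y - x) == 1%N) p.

(* The last two clauses say inf {n : ||p_n||_1 = N} = K. *)
Definition connects0 (N K : nat) (p : K.+1.-tuple Z3) : Prop :=
  [/\ tnth p ord0 = 0,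
      l1norm (tnth p ord_max) = N
    & forall i : 'I_K.+1, l1norm (tnth p i) = N -> (K <= i)%N].

Definition mutually_independent d (T : measurableType d) (R : realType)
    (P : probability T R) (E : Type) (Y : nat -> T -> E) : Prop :=
  forall (J : seq nat) (A : nat -> set E), uniq J ->
    P (\bigcap_(j in [set` J]) (Y j @^-1` A j)) =
    (\prod_(j <- J) P (Y j @^-1` A j))%E.

(* Z3 carries the discrete sigma-algebra: every subset of it is measurable. *)
Definition simple_random_walk d (T : measurableType d) (R : realType)
    (P : probability T R) (X : nat -> T -> Z3) : Prop :=
  let step n w := X n.+1 w - X n w in
  [/\ forall n (A : set Z3), measurable (X n @^-1` A),
      P [set w | X 0%N w = 0] = 1%E,
      forall n (i : 'I_3),
        P [set w | step n w = delta_mx 0 i] = (6^-1)%:E /\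
        P [set w | step n w = - delta_mx 0 i] = (6^-1)%:E
    & mutually_independent P step].

(* Main.v *)
Require Import Defs.
From mathcomp Require Import all_boot all_order all_algebra.
From mathcomp Require Import all_classical all_reals all_analysis.
From mathcomp Require Import ring lra zify.
Import Order.TTheory GRing.Theory Num.Theory.
Local Open Scope classical_set_scope.
Local Open Scope ring_scope.

(** Choose one point of the path on each level [||y||_1 = 1, ..., N].  Covering the
    path means visiting these [N] points [S], which are at pairwise [l1] distance at
    least the difference of their levels.  From any starting point the walk visits
    only [O(log N)] points of [S] on average, because the Green function decays like
    [1/|x|] and summing over levels gives a harmonic sum.  By the Markov property the
    number of visits then has exponential tails at scale [log N], so visiting all
    [N] points has probability at most [exp(- c N / log N)], which is stronger than the
    claim.

    The proof makes this explicit without the Green function.  The function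
    [pot x = (|x|^2 + 3)^(-1/2)] is superharmonic for the walk on all of the lattice
    ([pot_superharmonic]) and is at most [2 / (1 + ||x||_1)] ([pot_l1norm]).  For a
    superharmonic [g >= 0], let [h] be the sum of the translates of [g] centred at the
    points of [S], and suppose [h <= M].  Then for every [B > 0] the product
    [(1 - g 0 / (B + M))^|S| (1 + h/B)] dominates the probability of covering [S]
    ([covering_bound]): it is a supersolution of the recursion satisfied by that
    probability, in which [S] loses each point that is visited ([weight_step]).

    As [pot] is at most [7/8] of its maximum off the origin, a suitable multiple [B]
    of [M] makes the first factor beat the second for every size of [S], so no
    constant is left in front of the exponential ([covering_exp_bound]).  Here
    [M = 12 log N] is admissible ([sum_pot_levels]), and the factor
    [(log N)^(- eps)] of the claim, at most [(log 2)^(- eps)], goes into the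
    constant. *)

Set Implicit Arguments.
Unset Strict Implicit.
Unset Printing Implicit Defensive.

(** * The simple random walk and superharmonic functions *)

Definition unit_steps : seq Z3 :=
  [seq delta_mx 0 i | i <- index_enum 'I_3] ++
  [seq - delta_mx 0 i | i <- index_enum 'I_3].

Definition superharmonic (R : realType) (g : Z3 -> R) : Prop :=
  forall x, \sum_(e <- unit_steps) g (x + e) <= 6 * g x.

Lemma big_unit_steps (R : nmodType) (F : Z3 -> R) :
  \sum_(e <- unit_steps) F e =
  \sum_(i < 3) (F (delta_mx 0 i) + F (- delta_mx 0 i)).
Proof. by rewrite big_cat !big_map /= big_split. Qed.

Lemma unit_steps_uniq : uniq unit_steps.
Proof.
have dI : injective (fun i : 'I_3 => delta_mx 0 i : Z3).
  move=> i j /matrixP/(_ 0 i); rewrite !mxE !eqxx /=.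
  by case: eqVneq.
rewrite cat_uniq !map_inj_uniq ?index_enum_uniq //=; last by move=> i j /oppr_inj/dI.
rewrite andbT; apply/hasPn => _ /mapP[j _ ->]; apply/negP => /mapP[i _].
move=> /matrixP/(_ 0 j); rewrite !mxE !eqxx /=.
by case: (j == i).
Qed.

(** * An explicit superharmonic function on the lattice *)

Lemma le_of_sqr (R : realDomainType) (x y : R) :
  0 <= y -> x ^+ 2 <= y ^+ 2 -> x <= y.
Proof. by move=> y0 xy; rewrite leNgt; apply/negP => ?; nra. Qed.

(** Squaring removes the roots: the sum of squares is rational in [t] and [b], and
    the cross term is a geometric mean, at most the arithmetic mean.  The bound keeps
    the exact coefficient [3/4] of [b^2/t^2]: summed over three coordinates it meets
    the gain from passing from [t] to [t - 1] with equality at leading order, so no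
    loss in this coefficient is affordable. *)
Lemma inv_sqrt_pair (R : rcfType) (t b : R) :
  0 < t -> b ^+ 2 < t ^+ 2 ->
  (Num.sqrt (t + b))^-1 + (Num.sqrt (t - b))^-1 <=
  (2 + 3 / 4 * (b ^+ 2 / (t ^+ 2 - b ^+ 2))) * (Num.sqrt t)^-1.
Proof.
move=> t0 bt.
have tb : 0 < t + b by nra.
have tb' : 0 < t - b by nra.
have D0 : 0 < t ^+ 2 - b ^+ 2 by rewrite subr_gt0.
set w := b ^+ 2 / _.
have w0 : 0 <= w by rewrite divr_ge0 ?sqr_ge0 ?ltW.
set p := (Num.sqrt (t + b))^-1; set q := (Num.sqrt (t - b))^-1.
set r := (Num.sqrt t)^-1.
have p0 : 0 <= p by rewrite invr_ge0 sqrtr_ge0.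
have q0 : 0 <= q by rewrite invr_ge0 sqrtr_ge0.
have r0 : 0 <= r by rewrite invr_ge0 sqrtr_ge0.
have p2 : p ^+ 2 = (t + b)^-1 by rewrite exprVn sqr_sqrtr ?ltW.
have q2 : q ^+ 2 = (t - b)^-1 by rewrite exprVn sqr_sqrtr ?ltW.
have r2 : r ^+ 2 = t^-1 by rewrite exprVn sqr_sqrtr ?ltW.
have e1 : p ^+ 2 + q ^+ 2 = 2 * (1 + w) * r ^+ 2.
  rewrite p2 q2 r2 /w; field.
  by rewrite !gt_eqF //.
have e2 : (p * q) ^+ 2 = (1 + w) * r ^+ 2 * r ^+ 2.
  rewrite exprMn p2 q2 r2 /w; field.
  by rewrite !gt_eqF //.
(* the arithmetic mean of 1 and 1 + w bounds their geometric mean *)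
have e3 : p * q <= (1 + w / 2) * r ^+ 2.
  apply: le_of_sqr; first by rewrite mulr_ge0 ?sqr_ge0 //; lra.
  rewrite e2 (_ : (_ * r ^+ 2) ^+ 2 = (1 + w / 2) ^+ 2 * r ^+ 2 * r ^+ 2); last by ring.
  rewrite !ler_wpM2r ?sqr_ge0 //; nra.
apply: le_of_sqr; first by rewrite mulr_ge0 //; lra.
rewrite sqrrD exprMn.
have r2' : 0 <= r ^+ 2 by rewrite sqr_ge0.
nra.
Qed.

Lemma inv_sqrt_pred (R : rcfType) (t : R) :
  1 < t -> (6 + 3 / t) * (Num.sqrt t)^-1 <= 6 * (Num.sqrt (t - 1))^-1.
Proof.
move=> t1.
have t0 : 0 < t by lra.
have t10 : 0 < t - 1 by lra.
have tV : 0 < t^-1 by rewrite invr_gt0.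
have tt : t * t^-1 = 1 by rewrite mulfV ?gt_eqF.
rewrite ler_pdivlMr ?sqrtr_gt0 // mulrAC ler_pdivrMr ?sqrtr_gt0 //.
apply: le_of_sqr; first by rewrite mulr_ge0 ?sqrtr_ge0.
rewrite !exprMn !sqr_sqrtr; [|lra|lra].
have -> : (6 + 3 / t) ^+ 2 * (t - 1) = 36 * t - 27 * t^-1 - 9 * t^-1 ^+ 2.
  by field; rewrite gt_eqF.
nra.
Qed.

Definition normsq (R : realType) (x : Z3) : R := \sum_(i < 3) ((x 0 i)%:~R) ^+ 2.

(** A regularised Newton kernel.  In space the kernel [1/|x|] is harmonic off the
    origin, and the Laplacian of [(|x|^2 + a)^(-1/2)] is negative, of order
    [-a|x|^(-5)], which is the order of the error made in passing to the lattice.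
    Hence a large enough [a] makes the function superharmonic for the walk, and
    [a = 3] is large enough.  It stands in for the Green function, of which it has
    the decay, without any estimate of transition probabilities. *)
Definition pot (R : realType) (x : Z3) : R := (Num.sqrt (normsq R x + 3))^-1.

Lemma normsqD_delta (R : realType) (x : Z3) (i : 'I_3) (s : int) :
  normsq R (x + s *: delta_mx 0 i) =
  normsq R x + 2 * s%:~R * (x 0 i)%:~R + s%:~R ^+ 2.
Proof.
rewrite /normsq (bigD1 i) //= [in RHS](bigD1 i) //= !mxE !eqxx /= mulr1 intrD.
rewrite (eq_bigr (fun j => (x 0 j)%:~R ^+ 2)); first by ring.
by move=> j ji; rewrite !mxE (negPf ji) /= mulr0 addr0.
Qed.

Lemma normsq_ge0 (R : realType) (x : Z3) : 0 <= normsq R x.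
Proof. by apply: sumr_ge0 => i _; apply: sqr_ge0. Qed.

(** With [t = |x|^2 + 4], the two neighbours of [x] along an axis have
    [|y|^2 + 3 = t + b] and [t - b], where [b] is twice the coordinate, and the sum of
    the [b^2] is [4(t - 4)].  The pair estimate then bounds the sum over neighbours
    by [(6 + 3/t)/sqrt t], which is at most [6/sqrt (t - 1)]. *)
Lemma pot_superharmonic (R : realType) : superharmonic (@pot R).
Proof.
move=> x; rewrite big_unit_steps.
set n := normsq R x; have n0 : 0 <= n by exact: normsq_ge0.
pose t := n + 4; pose b (i : 'I_3) : R := 2 * (x 0 i)%:~R.
have sumb : \sum_i b i ^+ 2 = 4 * n.
  by rewrite /n /normsq mulr_sumr; apply: eq_bigr => i _; rewrite /b; ring.
have D0 : 0 < t ^+ 2 - 4 * n by rewrite /t; nra.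
have leb i : b i ^+ 2 <= 4 * n.
  by rewrite -sumb (bigD1 i) //= lerDl sumr_ge0 // => j _; apply: sqr_ge0.
pose r : R := (Num.sqrt t)^-1.
have r0 : 0 <= r by rewrite invr_ge0 sqrtr_ge0.
have t0 : 0 < t by rewrite /t; lra.
have step i : pot R (x + delta_mx 0 i) + pot R (x - delta_mx 0 i) <=
    (2 + 3 / 4 * (b i ^+ 2 / (t ^+ 2 - 4 * n))) * r.
  have E (s : int) : s ^+ 2 = 1 ->
      pot R (x + s *: delta_mx 0 i) = (Num.sqrt (t + s%:~R * b i))^-1.
    move=> s2; rewrite /pot normsqD_delta -/n -rmorphXn /= s2 /t /b.
    by congr (Num.sqrt _)^-1; ring.
  have := E 1 erefl; have := E (-1) erefl; rewrite scale1r scaleN1r => -> ->.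
  rewrite mulN1r mul1r; have bi := leb i.
  apply: (le_trans (@inv_sqrt_pair _ _ _ t0 _)); first by lra.
  rewrite ler_wpM2r // lerD2l ler_wpM2l // ?divr_ge0 // ler_wpM2l ?sqr_ge0 //.
  by rewrite lef_pV2 ?posrE //; lra.
apply: (le_trans (ler_sum _ (fun i _ => step i))).
rewrite -mulr_suml big_split /= -mulr_sumr -mulr_suml sumb sumr_const card_ord.
have -> : pot R x = (Num.sqrt (t - 1))^-1.
  by rewrite /pot -/n /t; congr (Num.sqrt _)^-1; ring.
apply: le_trans (@inv_sqrt_pred _ t _); last by rewrite /t; lra.
rewrite ler_wpM2r // lerD //; first by rewrite -mulr_natr; lra.
have : 4 * n / (t ^+ 2 - 4 * n) <= 4 / t.
  by rewrite ler_pdivrMr // mulrAC ler_pdivlMr // /t; nra.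
lra.
Qed.

Lemma pot_ge0 (R : realType) (x : Z3) : 0 <= pot R x.
Proof. by rewrite invr_ge0 sqrtr_ge0. Qed.

Lemma pot0_bounds (R : realType) : 1 / 2 <= pot R 0 <= 1.
Proof.
rewrite /pot (_ : normsq R 0 + 3 = 3); last first.
  by rewrite /normsq big1 ?add0r // => i _; rewrite mxE expr0n.
have s0 : 0 < Num.sqrt (3 : R) by rewrite sqrtr_gt0.
have s2 : Num.sqrt (3 : R) ^+ 2 = 3 by rewrite sqr_sqrtr.
have sV : Num.sqrt 3 * (Num.sqrt 3)^-1 = 1 :> R by rewrite mulfV ?gt_eqF.
have v0 : 0 < (Num.sqrt 3)^-1 :> R by rewrite invr_gt0.
by apply/andP; split; nra.
Qed.

Lemma normsq_ge1 (R : realType) (x : Z3) : x != 0 -> 1 <= normsq R x.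
Proof.
move=> /rV0Pn[i xi].
rewrite /normsq (bigD1 i) //=; apply: ler_wpDr.
  by apply: sumr_ge0 => j _; apply: sqr_ge0.
rewrite -rmorphXn /= (_ : 1 = 1%:~R) // ler_int.
have : 0 < x 0 i ^+ 2 by rewrite exprn_even_gt0.
by rewrite -gtz0_ge1.
Qed.

(** The ratio is at most [sqrt 3 / 2], and [7/8] is a rational number between this
    and 1.  Being strictly below 1 is what later absorbs the prefactor of the
    covering estimate. *)
Lemma pot_neq0 (R : realType) (x : Z3) : x != 0 -> pot R x <= 7 / 8 * pot R 0.
Proof.
move=> /(@normsq_ge1 R) n1.
rewrite /pot (_ : normsq R 0 = 0); last first.
  by rewrite /normsq big1 // => i _; rewrite mxE expr0n.
rewrite add0r.
have s0 : 0 < Num.sqrt (3 : R) by rewrite sqrtr_gt0.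
have s2 : Num.sqrt (3 : R) ^+ 2 = 3 by rewrite sqr_sqrtr.
have n0 : 0 < normsq R x + 3 by lra.
rewrite ler_pdivlMr // mulrC ler_pdivrMr ?sqrtr_gt0 //.
apply: le_of_sqr; first by rewrite mulr_ge0 ?sqrtr_ge0 //; lra.
rewrite exprMn s2 sqr_sqrtr; lra.
Qed.

Lemma pot_l1norm (R : realType) (x : Z3) : pot R x <= 2 / (l1norm x).+1%:R.
Proof.
set m : R := (l1norm x)%:R.
have m0 : 0 <= m by rewrite ler0n.
have mn : m ^+ 2 <= 3 * normsq R x.
  rewrite /m /l1norm /normsq natr_sum !big_ord_recl !big_ord0 /= !addr0.
  rewrite !natr_absz.
  set a := x _ _; set b := x _ _; set c := x _ _.
  have sq (z : int) : z%:~R ^+ 2 = `|z|%:~R ^+ 2 :> R.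
    by case: ger0P => _; rewrite ?rmorphN ?sqrrN.
  rewrite (sq a) (sq b) (sq c).
  move: (`|a|%:~R) (`|b|%:~R) (`|c|%:~R) => u v w.
  have := sqr_ge0 (u - v); have := sqr_ge0 (v - w); have := sqr_ge0 (u - w); nra.
have n0 := normsq_ge0 R x.
rewrite /pot ler_pdivlMr ?ltr0n // mulrC ler_pdivrMr ?sqrtr_gt0; last by lra.
apply: le_of_sqr; first by rewrite mulr_ge0 ?sqrtr_ge0 //; lra.
(* [(m + 1)^2 <= 4 (m^2 / 3 + 3)], as the difference has negative discriminant *)
rewrite exprMn sqr_sqrtr -?natr1 -/m; nra.
Qed.

(** * Events determined by finitely many positions *)

(** Finite sequences of lattice points are countable in number, so such an event is a
    countable union of cylinders.  This settles every measurability question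
    about events with a finite horizon. *)
Lemma measurable_determined d (T : measurableType d) (X : nat -> T -> Z3)
    (m : nat) (E : set T) :
  (forall n (A : set Z3), measurable (X n @^-1` A)) ->
  (forall w w', (forall j, (j < m)%N -> X j w = X j w') -> E w -> E w') ->
  measurable E.
Proof.
move=> mX detE.
pose h w := mkseq (X^~ w) m.
have -> : E = \bigcup_(l : seq Z3) [set w | E w /\ h w = l].
  by apply/seteqP; split => [w Ew|w [l _ []//]]; exists (h w).
apply: countable_bigcupT_measurable => // l.
have [[w0 [Ew0 hl]]|none] := pselect (exists w0, E w0 /\ h w0 = l); last first.
  rewrite (_ : mkset _ = set0) //; apply/seteqP; split => // w Ew.
  by case: none; exists w.
rewrite (_ : mkset _ = \bigcap_(j in `I_m) X j @^-1` [set X j w0]).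
  by apply: bigcap_measurableType => j _; exact: mX.
apply/seteqP; split => [w [_ hw] j /= jm|w /= Xw].
  have := congr1 (fun s => nth 0 s j) (etrans hw (esym hl)).
  by rewrite /h !nth_mkseq.
have Xww0 j : (j < m)%N -> X j w0 = X j w by move=> /Xw /= ->.
split; first exact: detE Ew0.
by rewrite -hl; apply/eq_in_map => j; rewrite mem_iota add0n => /andP[_ /Xww0 ->].
Qed.

Lemma measure_split d (T : measurableType d) (R : realType)
    (P : probability T R) (E : set T) (Y : T -> Z3) (s : seq Z3) :
  measurable E -> (forall A, measurable (Y @^-1` A)) -> uniq s ->
  P (E `&` [set w | Y w \in s]) =
  (\sum_(e <- s) P (E `&` [set w | Y w = e]))%E.
Proof.
move=> mE mY; elim: s => [_|e s IH /= /andP[es us]].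
  rewrite big_nil (_ : _ `&` _ = set0) ?measure0 //.
  by apply/seteqP; split => // w [].
rewrite big_cons -IH // -measureU.
- congr (P _); apply/seteqP; split => w.
    by case=> Ew /=; rewrite inE => /orP[/eqP|]; [left|right].
  by case=> -[Ew /= Yw]; split => //=; rewrite inE ?Yw ?eqxx ?orbT.
- by apply: measurableI => //; exact: (mY [set e]).
- by apply: measurableI => //; exact: (mY [set` s]).
- apply/seteqP; split => // w [[_ /= ->] [_ /=]].
  by rewrite (negPf es).
Qed.

Definition history {T : Type} (X : nat -> T -> Z3) (s : seq Z3) : set T :=
  [set w | X 0%N w = 0 /\
     forall j, (j < size s)%N -> X j.+1 w - X j w = nth 0 s j].

Definition covered {T : Type} (X : nat -> T -> Z3) (k n : nat) (S : seq Z3) : set T :=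
  [set w | forall y, y \in S -> exists2 m, (k <= m < k + n)%N & X m w = y].

Lemma measurable_history d (T : measurableType d) (X : nat -> T -> Z3) (s : seq Z3) :
  (forall n (A : set Z3), measurable (X n @^-1` A)) -> measurable (history X s).
Proof.
move=> mX; apply: (@measurable_determined _ _ X (size s).+1) => // w w' e [X0 Xs].
by split=> [|j js]; [rewrite -e|rewrite -(e j.+1) // -(e j) ?Xs //; lia].
Qed.

Lemma measurable_covered d (T : measurableType d) (X : nat -> T -> Z3)
    (k n : nat) (S : seq Z3) :
  (forall n (A : set Z3), measurable (X n @^-1` A)) -> measurable (covered X k n S).
Proof.
move=> mX; apply: (@measurable_determined _ _ X (k + n)) => // w w' e cw y.
by move=> /cw[m km Xm]; exists m => //; rewrite -e //; lia.
Qed.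

Lemma covered_by_some_time (T : Type) (X : nat -> T -> Z3) (S : seq Z3) (w : T) :
  [set` S] `<=` range (fun n => X n w) -> exists n, covered X 0 n S w.
Proof.
elim: S => [|y S IH] Sw; first by exists 0%N.
have [z zS|n Cn] := IH; first by apply: Sw => /=; rewrite inE zS orbT.
have [m _ Xm] := Sw y (mem_head _ _).
exists (maxn n m.+1) => z; rewrite inE => /orP[/eqP ->|zS].
  by exists m => //; lia.
by have [k kn Xk] := Cn z zS; exists k => //; lia.
Qed.

(** A finite set that is visited at all is visited before some finite time, so the
    bounds with a finite horizon pass to the limit. *)
Lemma cover_event_bigcup (T : Type) (X : nat -> T -> Z3) (S : seq Z3) :
  [set w | [set` S] `<=` range (fun n => X n w)] = \bigcup_n covered X 0 n S.
Proof.
apply/seteqP; split => [w Sw|].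
  by have [n Cn] := covered_by_some_time Sw; exists n.
by move=> w [n _ Cn] y /= /Cn[m _ Xm]; exists m.
Qed.

Lemma measurable_cover_event d (T : measurableType d) (X : nat -> T -> Z3) (S : seq Z3) :
  (forall n (A : set Z3), measurable (X n @^-1` A)) ->
  measurable [set w | [set` S] `<=` range (fun n => X n w)].
Proof.
move=> mX; rewrite cover_event_bigcup; apply: bigcup_measurable => n _.
exact: measurable_covered.
Qed.

Lemma history_position {T : Type} (X : nat -> T -> Z3) (s : seq Z3) (w : T) :
  history X s w -> X (size s) w = \sum_(e <- s) e.
Proof.
move=> [X0 Xs]; rewrite (big_nth 0) big_mkord.
suff pos j : (j <= size s)%N -> X j w = \sum_(i < j) nth 0 s i by exact: pos.
elim: j => [|j IH] js; first by rewrite big_ord0.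
by rewrite big_ord_recr /= -IH 1?ltnW // -Xs // addrC subrK.
Qed.

Lemma history_rcons {T : Type} (X : nat -> T -> Z3) (s : seq Z3) (e : Z3) (w : T) :
  history X s w -> X (size s).+1 w - X (size s) w = e -> history X (rcons s e) w.
Proof.
move=> [X0 Xs] Xe; split => // j; rewrite size_rcons ltnS nth_rcons leq_eqVlt.
by case: ltngtP => //= [/Xs|->].
Qed.

Lemma measurable_step d (T : measurableType d) (X : nat -> T -> Z3)
    (n : nat) (A : set Z3) :
  (forall n (A : set Z3), measurable (X n @^-1` A)) ->
  measurable [set w | A (X n.+1 w - X n w)].
Proof.
move=> mX; apply: (@measurable_determined _ _ _ n.+2 _ mX) => w w' e /=.
by rewrite !e.
Qed.

Lemma step_prob d (T : measurableType d) (R : realType) (P : probability T R)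
    (X : nat -> T -> Z3) (n : nat) (e : Z3) :
  simple_random_walk P X -> e \in unit_steps ->
  P [set w | X n.+1 w - X n w = e] = (6^-1)%:E.
Proof.
move=> [_ _ stepX _]; rewrite mem_cat => /orP[] /mapP[i _ ->].
  by case: (stepX n i).
by case: (stepX n i).
Qed.

Lemma step_unit d (T : measurableType d) (R : realType) (P : probability T R)
    (X : nat -> T -> Z3) (n : nat) :
  simple_random_walk P X ->
  P (~` [set w | X n.+1 w - X n w \in unit_steps]) = 0%E.
Proof.
move=> srw; have [mX _ _ _] := srw.
have mstep A := @measurable_step _ _ _ n A mX.
rewrite probability_setC; last exact: (mstep [set` unit_steps]).
have := @measure_split _ _ _ P setT (fun w => X n.+1 w - X n w) unit_steps
  measurableT mstep unit_steps_uniq.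
rewrite setTI => ->.
rewrite (eq_big_seq (fun _ => (6^-1)%:E)); last first.
  by move=> e eU; rewrite setTI; exact: step_prob srw eU.
rewrite sumEFin big_unit_steps sumr_const card_ord -EFinB.
by congr EFin; field.
Qed.

(** Prescribing the first steps is an intersection of independent events of
    probability [1/6]. *)
Lemma history_prob d (T : measurableType d) (R : realType) (P : probability T R)
    (X : nat -> T -> Z3) (s : seq Z3) :
  simple_random_walk P X -> all (mem unit_steps) s ->
  (P (history X s) <= (6^-1 ^+ size s)%:E)%E.
Proof.
move=> srw sU; have [mX _ _ indep] := srw.
have mstep n A := @measurable_step _ _ _ n A mX.
have := indep (iota 0 (size s)) (fun j => [set nth 0 s j]) (iota_uniq _ _).
rewrite [X in _ = X](_ : _ = (6^-1 ^+ size s)%:E) => [<-|]; last first.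
  rewrite (eq_big_seq (fun _ => (6^-1)%:E)); last first.
    move=> j; rewrite mem_iota add0n => /= js.
    by apply: step_prob => //; apply: (allP sU); exact: mem_nth.
  rewrite prodEFin (_ : iota 0 (size s) = index_iota 0 (size s)).
    by rewrite prodr_const_nat subn0.
  by rewrite /index_iota subn0.
apply: le_measure; rewrite ?inE.
- exact: measurable_history.
- by apply: bigcap_measurableType => j _; exact: mstep.
- by move=> w [_ Xs] j /=; rewrite mem_iota add0n => /Xs.
Qed.

(** * Covering a finite set *)

(** A supersolution for the probability that the walk started at [x] visits all of
    [S].  Each point of [S] not yet visited costs a fixed factor below 1; the second
    factor compensates, since the potential of [S] seen from the walk drops by [g 0]
    when a point of [S] is visited and hence removed. *)
Definition weight {R : realType} (g : Z3 -> R) (B M : R) (S : seq Z3) (x : Z3) : R :=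
  (1 - g 0 / (B + M)) ^+ size S * (1 + (\sum_(y <- S) g (x - y)) / B).

Lemma weight_ge0 (R : realType) (g : Z3 -> R) (B M : R) (S : seq Z3) (x : Z3) :
  (forall x, 0 <= g x) -> 0 < B -> 0 <= M -> g 0 <= B + M -> 0 <= weight g B M S x.
Proof.
move=> g0 B0 M0 gBM; have BM0 : 0 < B + M by lra.
rewrite mulr_ge0 ?exprn_ge0 //; first by rewrite subr_ge0 ler_pdivrMr // mul1r.
by rewrite addr_ge0 // divr_ge0 ?(ltW B0) // sumr_ge0.
Qed.

(** Off [S] this is superharmonicity of the potential of [S].  At a point of [S],
    the removal multiplies the first factor by the inverse of [1 - g 0 / (B + M)] and
    lowers the second by [g 0 / B]; the constant is chosen so that the product does
    not increase as long as the potential of [S] at the point is at most [M]. *)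
Lemma weight_step (R : realType) (g : Z3 -> R) (B M : R) (S : seq Z3) (x : Z3) :
  (forall x, 0 <= g x) -> superharmonic g -> 0 < B -> 0 <= M -> g 0 <= B + M -> uniq S ->
  \sum_(y <- S) g (x - y) <= M ->
  \sum_(e <- unit_steps) weight g B M [seq y <- S | y != x] (x + e) <=
  6 * weight g B M S x.
Proof.
move=> g0 gP B0 M0 gBM uS hM.
have h0 (S' : seq Z3) z : 0 <= \sum_(y <- S') g (z - y) by apply: sumr_ge0.
have BM0 : 0 < B + M by lra.
set mu := 1 - g 0 / (B + M).
have mu0 : 0 <= mu by rewrite subr_ge0 ler_pdivrMr // mul1r.
set S' := [seq y <- S | y != x].
pose h := \sum_(y <- S') g (x - y).
apply: (@le_trans _ _ (6 * (mu ^+ size S' * (1 + h / B)))).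
  rewrite /weight -/mu -mulr_sumr mulrCA ler_wpM2l ?exprn_ge0 //.
  rewrite big_split /= -mulr_suml mulrDr mulr1 lerD //.
    rewrite big_unit_steps sumr_const card_ord; lra.
  rewrite mulrA ler_wpM2r ?invr_ge0 1?(ltW B0) // exchange_big /= /h mulr_sumr.
  apply: ler_sum => y _; apply: le_trans (gP _).
  by apply: ler_sum => e _; rewrite addrAC.
rewrite ler_pM2l // /weight -/mu.
have [xS|xS] := boolP (x \in S); last first.
  have S'E : S' = S.
    by apply/all_filterP/allP => y yS; apply: contraNneq xS => <-.
  by rewrite /h S'E.
have pS : perm_eq S (x :: S').
  by rewrite /S' -(rem_filter _ uS) perm_to_rem.
have hM' : g 0 + h <= M by move: hM; rewrite (perm_big _ pS) big_cons subrr.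
rewrite (perm_size pS) (perm_big _ pS) /= big_cons subrr -/h exprSr -mulrA.
rewrite ler_wpM2l ?exprn_ge0 //.
have -> : mu * (1 + (g 0 + h) / B) = 1 + h / B + g 0 / B * (M - (g 0 + h)) / (B + M).
  by rewrite /mu; field; rewrite !gt_eqF.
by rewrite lerDl !mulr_ge0 ?invr_ge0 ?subr_ge0 // ltW.
Qed.

(** The Markov property is replaced by an induction on the length [n] of the time
    window, for all prescribed initial steps at once: one more step is fixed at each
    stage, the current position is removed from [S], and the six cases are summed by
    means of [weight_step]. *)
Lemma covered_finite_horizon d (T : measurableType d) (R : realType)
    (P : probability T R) (X : nat -> T -> Z3) (g : Z3 -> R) (B M : R) :
  simple_random_walk P X ->
  (forall x, 0 <= g x) -> superharmonic g -> 0 < B -> 0 <= M -> g 0 <= B + M ->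
  forall (n : nat) (S s : seq Z3), uniq S ->
    (forall x, \sum_(y <- S) g (x - y) <= M) -> all (mem unit_steps) s ->
    (P (history X s `&` covered X (size s) n S) <=
     (6^-1 ^+ size s * weight g B M S (\sum_(e <- s) e))%:E)%E.
Proof.
move=> srw g0 gP B0 M0 gBM; have [mX _ _ _] := srw.
have mE s k n S := measurableI _ _ (@measurable_history _ _ X s mX)
  (@measurable_covered _ _ X k n S mX).
have mstep n A := @measurable_step _ _ _ n A mX.
elim=> [|n IH] S s uS hM sU.
  case: S uS hM => [|y S] _ _.
    rewrite /weight big_nil mul0r addr0 expr0 !mulr1.
    apply: (@le_trans _ _ (P (history X s))); last exact: history_prob.
    by apply: measureIl; [exact: measurable_history|exact: measurable_covered].
  rewrite (_ : _ `&` _ = set0) ?measure0.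
    by rewrite lee_fin mulr_ge0 ?weight_ge0 ?exprn_ge0.
  apply/seteqP; split => // w [_ /(_ y)]; rewrite inE eqxx => /(_ isT)[m]; lia.
set E := _ `&` _; have mE0 : measurable E by exact: mE.
set x := \sum_(e <- s) e.
pose S' := [seq y <- S | y != x].
pose Y w := X (size s).+1 w - X (size s) w.
apply: (@le_trans _ _ (P (E `&` [set w | Y w \in unit_steps]))).
  rewrite -[leRHS]adde0 -(step_unit (size s) srw).
  have mU : measurable [set w | Y w \in unit_steps] by exact: (mstep _ [set` unit_steps]).
  have E1 := measurableI _ _ mE0 mU.
  have E2 : measurable (~` [set w | Y w \in unit_steps]) by exact: measurableC.
  apply: le_trans (measureU2 P E1 E2).
  apply: le_measure; rewrite ?inE; [exact: mE|exact: measurableU|].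
  by move=> w Ew; case: (pselect (Y w \in unit_steps)) => ?; [left|right].
rewrite measure_split //; [|by move=> A; exact: mstep|exact: unit_steps_uniq].
apply: (@le_trans _ _ (\sum_(e <- unit_steps)
    (6^-1 ^+ (size s).+1 * weight g B M S' (x + e))%:E)%E).
  rewrite big_seq [leRHS]big_seq; apply: lee_sum => e eU.
  have := IH S' (rcons s e); rewrite size_rcons big_rcons /= -/x => IHe.
  apply: le_trans (IHe _ _ _); last 3 first.
  - exact: filter_uniq.
  - move=> z; apply: le_trans (hM z); rewrite big_filter.
    rewrite [leRHS](bigID (fun y => y != x)) /= lerDl.
    exact: sumr_ge0.
  - by rewrite all_rcons sU andbT.
  apply: le_measure; rewrite ?inE //.
    by apply: measurableI; [exact: mE|exact: (mstep (size s) [set e])].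
  move=> w [[hw cw] /= Yw]; split; first exact: history_rcons.
  move=> y; rewrite mem_filter => /andP[yx yS].
  have [m /andP[km mk] Xm] := cw y yS.
  exists m => //; have : m != size s.
    by apply: contra_neq yx => ms; rewrite -Xm ms (history_position hw).
  by move: km mk; clear; lia.
rewrite sumEFin lee_fin -mulr_sumr exprSr -mulrA ler_wpM2l ?exprn_ge0 //.
rewrite ler_pdivrMl //.
exact: weight_step.
Qed.

Lemma covering_bound d (T : measurableType d) (R : realType)
    (P : probability T R) (X : nat -> T -> Z3) (g : Z3 -> R) (B M : R) (S : seq Z3) :
  simple_random_walk P X ->
  (forall x, 0 <= g x) -> superharmonic g -> 0 < B -> 0 <= M -> g 0 <= B + M ->
  uniq S -> (forall x, \sum_(y <- S) g (x - y) <= M) ->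
  (P [set w | [set` S] `<=` range (fun n => X n w)] <= (weight g B M S 0)%:E)%E.
Proof.
move=> srw g0 gP B0 M0 gBM uS hM; have [mX X0 _ _] := srw.
pose C n := covered X 0 n S.
have mC n : measurable (C n) by exact: measurable_covered.
rewrite cover_event_bigcup.
have ndC : nondecreasing_seq C.
  move=> m n mn; apply/subsetPset => w Cw y /Cw[k km Xk]; exists k => //; lia.
have mUC : measurable (\bigcup_n C n) by exact: bigcup_measurable.
have cvgC := nondecreasing_cvg_mu (mu := P) mC mUC ndC.
rewrite -(cvg_lim _ cvgC) //.
apply: lime_le; first by apply/cvg_ex; eexists; exact: cvgC.
apply: nearW => n /=.
have mH : measurable (history X [::]) by exact: measurable_history.
have nullC : P (~` history X [::]) = 0%E.
  rewrite probability_setC // (_ : history X [::] = [set w | X 0%N w = 0]).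
    by rewrite X0 subee.
  by apply/seteqP; split => w // [].
have m1 := measurableI _ _ mH (mC n).
apply: (@le_trans _ _ (P ((history X [::] `&` C n) `|` ~` history X [::]))).
  apply: le_measure; rewrite ?inE; [exact: mC| |].
    by apply: measurableU => //; exact: measurableC.
  by move=> w Cw; case: (pselect (history X [::] w)) => ?; [left|right].
apply: (@le_trans _ _ (P (history X [::] `&` C n) + P (~` history X [::]))%E).
  exact: measureU2 m1 (measurableC mH).
rewrite nullC adde0.
have := covered_finite_horizon srw g0 gP B0 M0 gBM n uS hM (isT : all _ [::]).
by rewrite /= big_nil expr0 mul1r.
Qed.

(** With [B = 14 M] the covering bound becomes a pure exponential.  Each point of [S]
    contributes at most [-g 0 / (15 M)] to the exponent from the first factor, and at
    most [(7/8) g 0 / (14 M) = g 0 / (16 M)] from the second; the sum is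
    [-g 0 / (240 M)]. *)
Lemma covering_exp_bound d (T : measurableType d) (R : realType)
    (P : probability T R) (X : nat -> T -> Z3) (g : Z3 -> R) (M : R) (S : seq Z3) :
  simple_random_walk P X ->
  (forall x, 0 <= g x) -> superharmonic g -> 0 < M -> g 0 <= M ->
  uniq S -> (forall x, \sum_(y <- S) g (x - y) <= M) ->
  {in S, forall y, g (- y) <= 7 / 8 * g 0} ->
  (P [set w | [set` S] `<=` range (fun n => X n w)] <=
   (expR (- ((size S)%:R * (g 0 / (240 * M)))))%:E)%E.
Proof.
move=> srw g0 gP M0 gM uS hM gS.
have B0 : 0 < 14 * M by lra.
have gBM : g 0 <= 14 * M + M by lra.
apply: le_trans (covering_bound srw g0 gP B0 (ltW M0) gBM uS hM) _.
rewrite lee_fin /weight.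
set n := size S; set h := \sum_(y <- S) _.
have hn : h <= n%:R * (7 / 8 * g 0).
  rewrite /h /n -sum1_size natr_sum mulr_suml big_seq [leRHS]big_seq.
  by apply: ler_sum => y yS; rewrite mul1r sub0r; exact: gS.
have x0 : 0 <= 1 - g 0 / (14 * M + M).
  by rewrite subr_ge0 ler_pdivrMr ?mul1r //; lra.
apply: (@le_trans _ _ (expR (- (g 0 / (14 * M + M))) ^+ n * expR (h / (14 * M)))).
  apply: ler_pM; last exact: expR_ge1Dx.
  - exact: exprn_ge0.
  - by rewrite addr_ge0 // divr_ge0 ?(ltW B0) // sumr_ge0.
  - by rewrite lerXn2r ?nnegrE ?expR_ge0 ?expR_ge1Dx.
rewrite -expRM_natl -expRD ler_expR.
apply: (@le_trans _ _ (n%:R * - (g 0 / (14 * M + M)) + n%:R * (7 / 8 * g 0) / (14 * M))).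
  by rewrite lerD2l ler_wpM2r ?invr_ge0 ?(ltW B0).
rewrite (_ : 14 * M + M = 15 * M); last by ring.
by rewrite [leLHS](_ : _ = - (n%:R * (g 0 / (240 * M)))) //; field; rewrite gt_eqF.
Qed.

(** * Levels of the path *)

Lemma l1normN (x : Z3) : l1norm (- x) = l1norm x.
Proof. by apply: eq_bigr => i _; rewrite mxE abszN. Qed.

Lemma l1norm_triangle (x y : Z3) : (l1norm (x + y) <= l1norm x + l1norm y)%N.
Proof.
rewrite /l1norm -big_split; apply: leq_sum => i _ /=; rewrite mxE.
by move: (x _ _) (y _ _) => a b; lia.
Qed.

Lemma l1norm_dist (x y : Z3) : (`|(l1norm x)%:Z - (l1norm y)%:Z| <= l1norm (x - y))%N.
Proof.
have := l1norm_triangle (x - y) y; have := l1norm_triangle (y - x) x.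
rewrite !subrK -(opprB x y) l1normN.
move: (l1norm x) (l1norm y) (l1norm (x - y)) => a b c.
by lia.
Qed.

(** The [l1] norm changes by at most one along an edge, so a path takes every
    intermediate value of it. *)
Lemma path_meets_level (x : Z3) (s : seq Z3) (j : nat) :
  path (fun x y : Z3 => l1norm (y - x) == 1%N) x s ->
  (l1norm x <= j <= l1norm (last x s))%N -> exists2 y, y \in x :: s & l1norm y = j.
Proof.
elim: s x => [|z s IH] x /=; first by move=> _ jx; exists x; rewrite ?mem_head //; lia.
move=> /andP[/eqP xz zs] /andP[xj js].
have [xj'|xj'] := eqVneq (l1norm x) j; first by exists x; rewrite ?mem_head.
have [|y ys yj] := IH z zs; last by exists y; rewrite // inE ys orbT.
have := l1norm_dist z x; rewrite js andbT xz.
by move: (l1norm x) (l1norm z) xj xj' => a b; lia.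
Qed.

(** Induction on [N] by removing the endpoint of [0, N] that is farther from [m]: its
    distance is at least [N/2], so its term is at most twice the last term of the
    harmonic sum. *)
Lemma sum_inv_dist (R : realType) (N m : nat) :
  \sum_(j < N) (`|(m%:Z - j%:Z)|.+1%N)%:R^-1 <= 2 * \sum_(k < N) (k.+1%:R^-1) :> R.
Proof.
elim: N m => [|N IH] m; first by rewrite !big_ord0 mulr0.
(* The case [N <= 2 * a] is that of a removed endpoint at distance [a]. *)
have half (a : nat) : (N <= 2 * a)%N -> (a.+1%:R)^-1 <= 2 * (N.+1%:R)^-1 :> R.
  move=> Na; rewrite -[leLHS]mul1r ler_pdivrMr ?ltr0n // mulrAC ler_pdivlMr ?ltr0n //.
  by rewrite mul1r -natrM ler_nat; lia.
rewrite [in leRHS]big_ord_recr /= mulrDr.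
have [Nm|mN] := leqP N (2 * m).
  rewrite big_ord_recl /= addrC; case: m Nm => [|m] Nm.
    have -> : N = 0%N by lia.
    by rewrite !big_ord0 /= invr1; lra.
  apply: lerD; last by apply: half; lia.
  apply: le_trans (IH m); apply: ler_sum => j _.
  by rewrite (_ : m.+1%:Z - (lift ord0 j)%:Z = m%:Z - j%:Z) //= /bump; lia.
rewrite big_ord_recr /=; apply: lerD; first exact: IH.
have -> : `|m%:Z - N%:Z|%N = (N - m)%N by lia.
by apply: half; lia.
Qed.

Lemma harmonic_ln (R : realType) (N : nat) :
  \sum_(k < N.+1) (k.+1%:R^-1) <= 1 + ln (N.+1%:R) :> R.
Proof.
elim: N => [|N IH]; first by rewrite big_ord1 invr1 ln1 addr0.
rewrite big_ord_recr /=.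
have E : ln (N.+1%:R : R) = ln (N.+2%:R) + ln (1 + - N.+2%:R^-1).
  rewrite -lnM ?posrE //.
    by congr ln; field.
  by rewrite subr_gt0 invf_lt1 ?ltr1n.
have := @le_ln1Dx R (- N.+2%:R^-1); rewrite ltrN2 invf_lt1 ?ltr1n //.
move=> /(_ isT) le; apply: (le_trans (lerD IH (lexx _))).
by rewrite E -!addrA lerD2l gerDl -lerBrDr sub0r.
Qed.

(** Points on different levels are at least as far apart as their levels, so from any
    [x] the potentials of one point per level are dominated by a harmonic sum. *)
Lemma sum_pot_levels (R : realType) (f : nat -> Z3) (N : nat) (x : Z3) :
  (2 <= N)%N -> (forall j, (j <= N)%N -> l1norm (f j) = j) ->
  \sum_(1 <= j < N.+1) pot R (x - f j) <= 4 * (1 + ln N%:R).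
Proof.
move=> N2 fl; rewrite big_add1 big_mkord /=.
(* Levels start at 1, whence the predecessor; at norm 0 its truncation only shortens
   the distances. *)
apply: (@le_trans _ _ (\sum_(j < N) 2 * (`|((l1norm x).-1)%:Z - j%:Z|.+1%N)%:R^-1)).
  apply: ler_sum => j _; apply: (le_trans (pot_l1norm _ _)).
  rewrite ler_wpM2l // lef_pV2 ?posrE ?ltr0n // ler_nat ltnS.
  have := l1norm_dist x (f j.+1); rewrite fl //; lia.
rewrite -mulr_sumr (_ : 4 = 2 * 2) -?mulrA ?ler_wpM2l //; last by rewrite -natrM.
apply: (le_trans (sum_inv_dist _ _ _)); rewrite ler_wpM2l //.
by case: N N2 {fl} => // N _; exact: harmonic_ln.
Qed.

Lemma ln_ge_half (R : realType) (N : nat) : (2 <= N)%N -> 1 / 2 <= ln (N%:R : R).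
Proof.
move=> N2; have N0 : (0 : R) < N%:R by rewrite ltr0n; lia.
apply: (@le_trans _ _ (ln 2)); last by rewrite ler_ln ?posrE // ler_nat.
have := @le_ln1Dx R (- 2^-1); rewrite (_ : 1 + - 2^-1 = 2^-1); last by lra.
by rewrite lnV ?posrE // => H; have := H ltac:(lra); lra.
Qed.

Theorem theorem1p3 (R : realType) (eps : R) (heps : 0 < eps) :
  exists c : R, 0 < c /\
    forall (N K : nat) (p : K.+1.-tuple Z3),
      (2 <= N)%N -> nearest_neighbor p -> connects0 N p ->
      forall (d : measure_display) (T : measurableType d)
        (P : probability T R) (X : nat -> T -> Z3),
        simple_random_walk P X ->
        (P [set w | [set` p] `<=` range (fun n => X n w)] <=
         (expR (- (c * N%:R * (ln N%:R `^ (- (1 + eps))))))%:E)%E.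
Proof.
have l2 := @ln_ge_half R 2 isT.
have l20 : 0 < ln (2 : R) by lra.
(* The potential at the origin is at least 1/2, and the covering bound, whose constant
   is 240, is used with [M = 12 * ln N]. *)
pose k : R := 2 * (240 * 12).
have k0 : 0 < k by rewrite !mulr_gt0 ?ltr0n.
exists (ln 2 `^ eps / k); split; first by rewrite divr_gt0 ?powR_gt0.
move=> N K p N2 nnp [p0 pN _] d T P X srw.
(* Above level [N] the point is arbitrary; this makes the choice a total function. *)
have level (j : nat) : exists y, (j <= N)%N -> y \in p /\ l1norm y = j.
  have [jN|_] := leqP j N; last by exists 0.
  case: p p0 pN nnp => -[//|x s] sz.
  rewrite /nearest_neighbor !(tnth_nth 0) /= => x0 lN xs.
  have sK : size s = K by case/eqP: (sz).
  have [|y yp yj] := path_meets_level xs (j := j); last by exists y.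
  by rewrite (last_nth 0) sK lN jN x0 /l1norm big1 // => i _; rewrite mxE.
have [f fP] := choice level.
have fl j : (j <= N)%N -> l1norm (f j) = j by move=> /fP[].
pose S := map f (index_iota 1 N.+1).
have [mX _ _ _] := srw.
apply: (@le_trans _ _ (P [set w | [set` S] `<=` range (fun n => X n w)])).
  apply: le_measure; rewrite ?inE; [exact: measurable_cover_event..|].
  move=> w pw; apply: subset_trans pw => y /= /mapP[j].
  by rewrite mem_index_iota => /andP[_ jN] ->; case: (fP j jN).
have lN := @ln_ge_half R N N2.
have := pot0_bounds R; move=> /andP[g1 g2].
pose M : R := 12 * ln N%:R.
have uS : uniq S.
  rewrite map_inj_in_uniq ?iota_uniq // => i j; rewrite !mem_index_iota => iN jN fij.
  by rewrite -(fl i) ?fij ?fl; lia.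
have gP := @pot_superharmonic R.
apply: le_trans (covering_exp_bound (M := M) srw (@pot_ge0 R) gP _ _ uS _ _) _.
- by rewrite /M; lra.
- by rewrite /M; lra.
- move=> x; rewrite big_map; apply: (le_trans (sum_pot_levels _ _ N2 fl)).
  by rewrite /M; lra.
- move=> y /mapP[j]; rewrite mem_index_iota => /andP[j1 jN] ->.
  apply: pot_neq0; rewrite oppr_eq0; apply: contraTneq j1 => fj0.
  by rewrite -(fl j jN) fj0 /l1norm big1 // => i _; rewrite mxE.
rewrite lee_fin ler_expR lerN2 size_map size_iota subn1 /=.
rewrite -mulrA mulrCA ler_wpM2l //.
have L0 : 0 < ln (N%:R : R) by lra.
rewrite powRN powRD ?(gt_eqF L0) ?implybT // powRr1 ?(ltW L0) //.
have e0 : 0 < ln (N%:R : R) `^ eps by rewrite powR_gt0.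
apply: (@le_trans _ _ (1 / (k * ln N%:R))).
  rewrite ler_pdivrMr ?mulr_gt0 //.
  have -> : 1 / (k * ln N%:R) * (ln N%:R * ln N%:R `^ eps) = ln (N%:R : R) `^ eps / k.
    by field; rewrite !gt_eqF.
  rewrite ler_wpM2r ?invr_ge0 ?(ltW k0) //; apply: ge0_ler_powR;
    rewrite ?nnegrE ?(ltW l20) ?(ltW L0) ?(ltW heps) //.
  by rewrite ler_ln ?posrE ?ltr0n // ?ler_nat //; lia.
rewrite (_ : k * ln N%:R = 2 * (240 * M)); last by rewrite /k /M !mulrA.
have M0 : 0 < 240 * M by rewrite !mulr_gt0 ?ltr0n.
by rewrite invfM mulrA ler_wpM2r ?invr_ge0 ?(ltW M0).
Qed.
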